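(* (1) The class $\mathcal{A}uto$ is closed under the sum (disjoint union) and under the Cartesian, lexicographic and categorical products: if $G_1, G_2 \in \mathcal{A}uto$, then $G_1+G_2$, $G_1\times G_2$, $G_1[G_2]$ and $G_1\cdot G_2$ all belong to $\mathcal{A}uto$. (2) Moreover, $\mathcal{A}uto$ is an ideal with respect to the categorical product: if $G\in\mathcal{A}uto$ and $H$ is an arbitrary graph, then both $G\cdot H$ and $H\cdot G$ belong to $\mathcal{A}uto$.
   Context: All graphs are finite simple graphs. An automorphism $\phi$ of a graph $G$ induces a permutation $\phi'$ of $E(G)$ by $\phi'(\{u,v\})=\{\phi(u),\phi(v)\}$; $\phi$ is involutory if it has order 2. $\mathcal{A}uto$ denotes the class of all graphs $G$ having an involutory automorphism $\phi$ such that $\phi'$ fixes no edge. For graphs $G_1,G_2$ with disjoint vertex sets, the sum $G_1+G_2$ has vertex set $V(G_1)\cup V(G_2)$ and edge set $E(G_1)\cup E(G_2)$. The three products have vertex set $V(G_1)\times V(G_2)$, and $(u_1,u_2)$, $(v_1,v_2)$ are adjacent: in the Cartesian product $G_1\times G_2$ iff either $u_1=v_1$ and $\{u_2,v_2\}\in E(G_2)$, or $u_2=v_2$ and $\{u_1,v_1\}\in E(G_1)$; in the lexicographic product $G_1[G_2]$ iff either $\{u_1,v_1\}\in E(G_1)$, or $u_1=v_1$ and $\{u_2,v_2\}\in E(G_2)$; in the categorical product $G_1\cdot G_2$ iff $\{u_1,v_1\}\in E(G_1)$ and $\{u_2,v_2\}\in E(G_2)$. *)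

(* Defs.v *)
From mathcomp Require Import all_boot all_fingroup.

Set Implicit Arguments.
Unset Strict Implicit.
Unset Printing Implicit Defensive.

(* The vertex type may be empty. *)
Record sgraph := SGraph {
  vertex :> finType;
  adj : rel vertex;
  adj_sym : symmetric adj;
  adj_irrefl : irreflexive adj }.

Definition edges (G : sgraph) : {set {set G}} :=
  [set e : {set G} | [exists u, exists v, adj u v && (e == [set u; v])]].

Lemma mem_edges (G : sgraph) (u v : G) : ([set u; v] \in edges G) = adj u v.
Proof.
rewrite inE; apply/existsP/idP => [[x] | uv]; last first.
  by exists u; apply/existsP; exists v; rewrite uv eqxx.
case/existsP=> y /andP[xy /eqP Euv].
have nuv : u != v.
  apply/eqP => uv; move: (congr1 (fun A : {set G} => #|A|) Euv).
  by rewrite uv !cards2 eqxx; case: eqP xy => // ->; rewrite adj_irrefl.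
have /set2P[ux|uy] : u \in [set x; y] by rewrite -Euv set21.
  have /set2P[vx|vy] : v \in [set x; y] by rewrite -Euv set22.
    by rewrite ux vx eqxx in nuv.
  by rewrite ux vy.
have /set2P[vx|vy] : v \in [set x; y] by rewrite -Euv set22.
  by rewrite uy vx adj_sym.
by rewrite uy vy eqxx in nuv.
Qed.

Definition is_automorphism (G : sgraph) (phi : {perm G}) : Prop :=
  forall u v : G, adj (phi u) (phi v) = adj u v.

(* The map {u, v} |-> {phi u, phi v}, defined on all sets of vertices. *)
Definition induced (G : sgraph) (phi : {perm G}) (e : {set G}) : {set G} :=
  phi @: e.

Definition Auto (G : sgraph) : Prop :=
  exists phi : {perm G},
    [/\ is_automorphism phi, #[phi]%g = 2
      & forall e : {set G}, e \in edges G -> induced phi e <> e].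

Section Operations.

Variables G1 G2 : sgraph.

Definition sum_adj : rel (G1 + G2)%type := fun x y =>
  match x, y with
  | inl u, inl v => adj u v
  | inr u, inr v => adj u v
  | _, _ => false
  end.

Definition cart_adj : rel (G1 * G2)%type := fun u v =>
  (u.1 == v.1) && adj u.2 v.2 || (u.2 == v.2) && adj u.1 v.1.

Definition lex_adj : rel (G1 * G2)%type := fun u v =>
  adj u.1 v.1 || (u.1 == v.1) && adj u.2 v.2.

Definition cat_adj : rel (G1 * G2)%type := fun u v =>
  adj u.1 v.1 && adj u.2 v.2.

Lemma sum_adj_sym : symmetric sum_adj.
Proof. by case=> u [] v //=; apply: adj_sym. Qed.

Lemma sum_adj_irrefl : irreflexive sum_adj.
Proof. by case=> u /=; apply: adj_irrefl. Qed.

Lemma cart_adj_sym : symmetric cart_adj.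
Proof.
move=> u v; rewrite /cart_adj (adj_sym u.1) (adj_sym u.2).
by rewrite (eq_sym u.1) (eq_sym u.2).
Qed.

Lemma cart_adj_irrefl : irreflexive cart_adj.
Proof. by move=> u; rewrite /cart_adj !adj_irrefl !andbF. Qed.

Lemma lex_adj_sym : symmetric lex_adj.
Proof.
by move=> u v; rewrite /lex_adj (adj_sym u.1) (adj_sym u.2) (eq_sym u.1).
Qed.

Lemma lex_adj_irrefl : irreflexive lex_adj.
Proof. by move=> u; rewrite /lex_adj !adj_irrefl andbF. Qed.

Lemma cat_adj_sym : symmetric cat_adj.
Proof. by move=> u v; rewrite /cat_adj (adj_sym u.1) (adj_sym u.2). Qed.

Lemma cat_adj_irrefl : irreflexive cat_adj.
Proof. by move=> u; rewrite /cat_adj !adj_irrefl. Qed.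

Definition sum_graph : sgraph := SGraph sum_adj_sym sum_adj_irrefl.
Definition cartesian_product : sgraph := SGraph cart_adj_sym cart_adj_irrefl.
Definition lexicographic_product : sgraph := SGraph lex_adj_sym lex_adj_irrefl.
Definition categorical_product : sgraph := SGraph cat_adj_sym cat_adj_irrefl.

End Operations.

(* Main.v *)
(* An involution f fixes the edge {u, v} exactly when it swaps u and v or fixes
   both of them. In the sum and in each product, every edge projects onto an
   edge of some factor; the involution acting componentwise restricts to the
   given one on that factor, so it can neither swap nor fix the two ends. In the
   categorical product every edge projects onto edges of both factors, so the
   identity may be taken on one of them. *)
Require Import Defs.
From mathcomp Require Import all_boot all_fingroup cyclic.

(** For an involution [f u = v] already gives [f v = u], so [f u <> v] alone excludes a swap. *)
Definition edge_free (G : sgraph) (f : G -> G) : Prop :=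
  forall u v : G, adj u v -> f u <> v /\ ~ (f u = u /\ f v = v).

Definition edge_free_involution (G : sgraph) (f : G -> G) : Prop :=
  [/\ involutive f, forall u v : G, adj (f u) (f v) = adj u v & edge_free G f].

(** Trades permutations and edge sets for plain functions and adjacent pairs, so that maps on sums
    and products can be written componentwise. The moved vertex encodes that the order is 2 rather
    than 1. *)
Lemma AutoP (G : sgraph) :
  Auto G <-> exists2 f, edge_free_involution G f & exists u, f u <> u.
Proof.
split=> [[phi [phi_aut phi2 phi_free]] | [f [fK f_aut f_free] [w fw]]].
  exists phi; first split=> // [u | u v uv].
  - by rewrite -permM -expg2 -phi2 expg_order perm1.
  - have phiK : phi (phi u) = u by rewrite -permM -expg2 -phi2 expg_order perm1.
    have uvE : [set u; v] \in edges G by rewrite mem_edges.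
    split=> [phi_u | [phi_u phi_v]]; apply: (phi_free _ uvE).
    + by rewrite /induced imsetU1 imset_set1 -phi_u phiK setUC.
    + by rewrite /induced imsetU1 imset_set1 phi_u phi_v.
  have /existsP[u /eqP] : [exists u, phi u != u]; last by exists u.
  apply: contra_eqT phi2 => /existsPn phi1.
  suff -> : phi = 1%g by rewrite order1.
  by apply/permP=> u; rewrite perm1; apply/eqP; rewrite -[_ == _]negbK.
exists (perm (inv_inj fK)); split=> [u v | | e].
- by rewrite !permE.
(* As 2 is prime, it suffices that the square is the identity and that [w] is moved. *)
- apply: nt_prime_order => //.
    by apply/permP=> u; rewrite expg2 permM !permE fK.
  by apply/eqP=> /permP/(_ w); rewrite permE perm1.
rewrite inE => /existsP[u /existsP[v /andP[uv /eqP ->]]].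
have [fuv fix_uv] := f_free u v uv.
rewrite /induced imsetU1 imset_set1 !permE => E.
(* Only [f u = u] survives; then [f v = u] would give [f u = v] by involutivity, and [f v = v] would
   fix both ends. *)
have /set2P[fu | //] : f u \in [set u; v] by rewrite -E set21.
have /set2P[fv | fv] : f v \in [set u; v] by rewrite -E set22.
- by apply: fuv; rewrite -fv fK.
- exact: fix_uv.
Qed.

Lemma Auto_nonempty (G : sgraph) : Auto G -> 0 < #|G|.
Proof. by case/AutoP=> f _ [u _]; apply/card_gt0P; exists u. Qed.

Lemma Auto_sum (G1 G2 : sgraph) :
  Auto G1 -> Auto G2 -> Auto (sum_graph G1 G2).
Proof.
move=> /AutoP[f [fK f_aut f_free] [w fw]] /AutoP[g [gK g_aut g_free] _].
apply/AutoP; exists (fun x => match x with inl u => inl (f u) | inr v => inr (g v) end).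
  split=> [[u|u] | [u|u] [v|v] | [u|u] [v|v]] //=; rewrite ?fK ?gK //.
  - by case/f_free=> fuv fix_uv; split=> [[] | [[fu] [fv]]] //; apply: fix_uv.
  - by case/g_free=> guv fix_uv; split=> [[] | [[gu] [gv]]] //; apply: fix_uv.
by exists (inl w) => -[].
Qed.

Definition pair_map (S T : Type) (f : S -> S) (g : T -> T) (u : S * T) :=
  (f u.1, g u.2).

Lemma pair_map_involutive (S T : Type) (f : S -> S) (g : T -> T) :
  involutive f -> involutive g -> involutive (pair_map S T f g).
Proof. by move=> fK gK [u v]; rewrite /pair_map /= fK gK. Qed.

(** If [h] swapped or fixed the two pairs, [f] would do the same to their first coordinates. The map
    [g] is arbitrary, so the identity is allowed. *)
Lemma edge_free_fst (G : sgraph) (T : Type) (f : G -> G) (g : T -> T)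
    (u v : G * T) :
  edge_free G f -> adj u.1 v.1 ->
  let h := pair_map G T f g in h u <> v /\ ~ (h u = u /\ h v = v).
Proof.
case: u v => [u1 u2] [v1 v2] f_free /f_free[fuv fix_uv].
by split=> [[] | [[fu _] [fv _]]] //; apply: fix_uv.
Qed.

Lemma edge_free_snd (G : sgraph) (T : Type) (f : T -> T) (g : G -> G)
    (u v : T * G) :
  edge_free G g -> adj u.2 v.2 ->
  let h := pair_map T G f g in h u <> v /\ ~ (h u = u /\ h v = v).
Proof.
case: u v => [u1 u2] [v1 v2] g_free /g_free[guv fix_uv].
by split=> [[] | [[_ gu] [_ gv]]] //; apply: fix_uv.
Qed.

Lemma Auto_cartesian (G1 G2 : sgraph) :
  Auto G1 -> Auto G2 -> Auto (cartesian_product G1 G2).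
Proof.
move=> /AutoP[f [fK f_aut f_free] [w fw]] /AutoP[g [gK g_aut g_free] [z _]].
(* [w] is moved by [f]; [z] only fills the second coordinate. *)
apply/AutoP; exists (pair_map G1 G2 f g); last by exists (w, z) => -[].
split=> [|u v|u v]; first exact: pair_map_involutive.
- rewrite /= /cart_adj /= f_aut g_aut.
  by rewrite (inj_eq (inv_inj fK)) (inj_eq (inv_inj gK)).
- by case/orP=> /andP[_]; [apply: edge_free_snd | apply: edge_free_fst].
Qed.

Lemma Auto_lexicographic (G1 G2 : sgraph) :
  Auto G1 -> Auto G2 -> Auto (lexicographic_product G1 G2).
Proof.
move=> /AutoP[f [fK f_aut f_free] [w fw]] /AutoP[g [gK g_aut g_free] [z _]].
apply/AutoP; exists (pair_map G1 G2 f g); last by exists (w, z) => -[].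
split=> [|u v|u v]; first exact: pair_map_involutive.
- by rewrite /= /lex_adj /= f_aut g_aut (inj_eq (inv_inj fK)).
- by case/orP=> [|/andP[_]]; [apply: edge_free_fst | apply: edge_free_snd].
Qed.

(** A vertex of [H] is required to build a moved vertex: over an empty [H] the product has no
    vertices, hence no automorphism of order 2. *)
Lemma Auto_categorical_l (G H : sgraph) :
  Auto G -> 0 < #|H| -> Auto (categorical_product G H).
Proof.
move=> /AutoP[f [fK f_aut f_free] [w fw]] /card_gt0P[z _].
apply/AutoP; exists (pair_map G H f id); last by exists (w, z) => -[].
split=> [|u v|u v]; first exact: pair_map_involutive.
- by rewrite /= /cat_adj /= f_aut.
- by case/andP=> uv _; apply: edge_free_fst.
Qed.

Lemma Auto_categorical_r (G H : sgraph) :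
  Auto G -> 0 < #|H| -> Auto (categorical_product H G).
Proof.
move=> /AutoP[f [fK f_aut f_free] [w fw]] /card_gt0P[z _].
apply/AutoP; exists (pair_map H G id f); last by exists (z, w) => -[].
split=> [|u v|u v]; first exact: pair_map_involutive.
- by rewrite /= /cat_adj /= f_aut.
- by case/andP=> _; apply: edge_free_snd.
Qed.

Theorem theorem2 :
  (forall G1 G2 : sgraph, Auto G1 -> Auto G2 ->
     [/\ Auto (sum_graph G1 G2),
         Auto (cartesian_product G1 G2),
         Auto (lexicographic_product G1 G2)
       & Auto (categorical_product G1 G2)])
  /\
  (forall G H : sgraph, Auto G -> 0 < #|H| ->
     Auto (categorical_product G H) /\ Auto (categorical_product H G)).
Proof.
split=> [G1 G2 G1A G2A | G H GA H0]; split.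
- exact: Auto_sum.
- exact: Auto_cartesian.
- exact: Auto_lexicographic.
(* Closure is a case of the ideal property, as the moved vertex makes [G2] nonempty. *)
- exact: Auto_categorical_l (Auto_nonempty _ G2A).
- exact: Auto_categorical_l.
- exact: Auto_categorical_r.
Qed.
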